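(* Fix an integer $p \geq 2$, a real number $\beta > 0$ and a sequence $\{\boldsymbol{J}_N\}_{N \geq 1}$ of symmetric $p$-tensors with zero diagonals ($\boldsymbol J_N$ having all indices in $\{1,\ldots,N\}$) such that the following two conditions hold: (1) $\sup_{N\geq 1}\mathbb{E}_{\beta}\big[ \|\boldsymbol{J}_N(\boldsymbol Z)\|^4\big] <\infty$, where the expectation is taken with respect to $\boldsymbol Z \sim \mathbb{P}_{\beta}$ (the $p$-tensor Ising model with interaction tensor $\boldsymbol J_N$ and parameter $\beta$) and $\boldsymbol J_N(\cdot)$ is the local interaction matrix; (2) $\liminf_{N\rightarrow \infty} \frac{1}{N}F_N(\beta) > 0$. Then, given a single sample $\boldsymbol X\sim\mathbb{P}_\beta$ from the model with interaction tensor $\boldsymbol J_N$, the maximum pseudo-likelihood (MPL) estimate $\hat{\beta}_N(\boldsymbol X)$ is $\sqrt N$-consistent for $\beta$; that is, for every $\delta > 0$ there exists $M=M(\delta, \beta) > 0$ such that $$\mathbb{P}_{\beta}\big(\sqrt N\, |\hat \beta_N(\boldsymbol X) - \beta| \leq M \big) > 1-\delta$$ for all $N$ large enough.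
   Context: Let $\mathcal{C}_N=\{-1,1\}^N$. A $p$-tensor is $\boldsymbol J_N=((J_{i_1\ldots i_p}))_{1\leq i_1,\ldots,i_p\leq N}$ with real entries. Standing assumptions: $\boldsymbol J_N$ is symmetric (entries invariant under permutations of the indices) and has zero diagonals ($J_{i_1\ldots i_p}=0$ whenever $i_s=i_t$ for some $s<t$). The $p$-tensor Ising model with interaction tensor $\boldsymbol J_N$ and parameter $\beta\ge 0$ is the probability distribution on $\mathcal{C}_N$ given by $\mathbb{P}_{\beta}(\boldsymbol x)=\frac{1}{2^N Z_N(\beta)}e^{\beta H_N(\boldsymbol x)}$, where $H_N(\boldsymbol x)=\sum_{1\leq i_1,\ldots,i_p\leq N}J_{i_1\ldots i_p}x_{i_1}\cdots x_{i_p}$ and $Z_N(\beta)=\frac{1}{2^N}\sum_{\boldsymbol x\in\mathcal{C}_N}e^{\beta H_N(\boldsymbol x)}$. The log-partition function is $F_N(\beta)=\log Z_N(\beta)$. $\mathbb{E}_\beta$ denotes expectation under $\mathbb{P}_\beta$. For $1\le i\le N$, $m_i(\boldsymbol x)=\sum_{1\leq i_2,\ldots,i_p\leq N}J_{i i_2\ldots i_p}x_{i_2}\cdots x_{i_p}$. The MPL estimate is $$\hat\beta_N(\boldsymbol X)=\inf\Big\{b\geq 0: H_N(\boldsymbol X)=\sum_{i=1}^N m_i(\boldsymbol X)\tanh\big(p\,b\,m_i(\boldsymbol X)\big)\Big\},$$ with the infimum of the empty set equal to $+\infty$. The local interaction matrix of $\boldsymbol J_N$ at $\boldsymbol x\in\mathcal{C}_N$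 is the $N\times N$ matrix $\boldsymbol J_N(\boldsymbol x)=((J_{i_1i_2}(\boldsymbol x)))$ with $J_{i_1i_2}(\boldsymbol x)=\sum_{1\leq i_3,\ldots,i_p\leq N}J_{i_1i_2i_3\ldots i_p}x_{i_3}\cdots x_{i_p}$ (for $p=2$, $\boldsymbol J_N(\boldsymbol x)=\boldsymbol J_N$). For a matrix $A$, $\|A\|$ is the Euclidean operator norm. *)

(* Defs.v *)
From mathcomp Require Import all_boot all_order all_algebra all_fingroup.
From mathcomp Require Import all_classical all_reals all_analysis.
Import Order.TTheory GRing.Theory Num.Theory.
Import numFieldNormedType.Exports.

Set Implicit Arguments.
Unset Strict Implicit.
Unset Printing Implicit Defensive.

Local Open Scope classical_set_scope.
Local Open Scope ring_scope.

Definition tanh (R : realType) (x : R) : R :=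
  (expR x - expR (- x)) / (expR x + expR (- x)).

(* The Euclidean norm; the library's [`|u|] on matrices is the sup norm. *)
Definition l2norm (R : realType) (n : nat) (u : 'cV[R]_n) : R :=
  Num.sqrt (\sum_(i < n) u i 0 ^+ 2).

Definition opnorm (R : realType) (n : nat) (A : 'M[R]_n) : R :=
  sup [set l2norm (A *m u) | u in [set u : 'cV[R]_n | l2norm u <= 1]].

Definition tensor (R : realType) (p N : nat) := p.-tuple 'I_N -> R.

Definition symmetric_tensor (R : realType) (p N : nat) (J : tensor R p N) :=
  forall (s : 'S_p) (t : p.-tuple 'I_N), J [tuple tnth t (s k) | k < p] = J t.

Definition zero_diagonal (R : realType) (p N : nat) (J : tensor R p N) :=
  forall (t : p.-tuple 'I_N) (k l : 'I_p),
    (k < l)%N -> tnth t k = tnth t l -> J t = 0.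

(* Points of {-1,1}^N are encoded by their sign bits: [x i = true] means that
   the i-th coordinate is -1; [spin x i] is that coordinate. *)
Definition config (N : nat) := {ffun 'I_N -> bool}.

Definition spin (R : realType) (N : nat) (x : config N) (i : 'I_N) : R :=
  (-1) ^+ x i.

Section Ising.
Context (R : realType) (p N : nat).
Implicit Types (J : tensor R p N) (x : config N) (beta : R).

Definition hamiltonian J x : R :=
  \sum_(t : p.-tuple 'I_N) J t * \prod_(k <- t) spin R x k.

(* The sum over (i_2, ..., i_p) is written as a sum over the p-tuples whose
   first entry is i. *)
Definition local_field J x (i : 'I_N) : R :=
  \sum_(t : p.-tuple 'I_N | take 1 t == [:: i])
     J t * \prod_(k <- drop 1 t) spin R x k.

Definition local_interaction J x : 'M[R]_N :=
  \matrix_(i, j) \sum_(t : p.-tuple 'I_N | take 2 t == [:: i; j])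
                    J t * \prod_(k <- drop 2 t) spin R x k.

Definition partition_function J beta : R :=
  (2 ^+ N)^-1 * \sum_(x : config N) expR (beta * hamiltonian J x).

Definition log_partition J beta : R := ln (partition_function J beta).

Definition ising J beta x : R :=
  expR (beta * hamiltonian J x) / (2 ^+ N * partition_function J beta).

Definition ising_expectation J beta (f : config N -> R) : R :=
  \sum_(x : config N) ising J beta x * f x.

Definition ising_prob J beta (A : set (config N)) : R :=
  \sum_(x : config N | x \in A) ising J beta x.

(* Extended-real valued: [ereal_inf set0 = +oo]. *)
Definition mpl J x : \bar R :=
  ereal_inf (EFin @` [set b : R | 0 <= b /\
    hamiltonian J x =
      \sum_(i < N) local_field J x i * tanh (p%:R * b * local_field J x i)]).

End Ising.

(* Main.v *)
Require Import Defs.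
From mathcomp Require Import all_boot all_order all_algebra all_fingroup.
From mathcomp Require Import all_classical all_reals all_analysis.
From mathcomp Require Import ring lra.
Import Order.TTheory GRing.Theory Num.Theory.
Import numFieldNormedType.Exports.
Local Open Scope classical_set_scope.
Local Open Scope ring_scope.

Set Implicit Arguments.
Unset Strict Implicit.
Unset Printing Implicit Defensive.

(** The estimate solves [score = 0] in the parameter, where the score at [b] is
    [\sum_i m i * (x i - tanh (p * b * m i))], the [m i] being the local fields.
    It is within [M / sqrt N] of [beta] because the score is small at [beta] and
    steep around it.

    Small: under the model, [tanh (p * beta * m i)] is the conditional mean of the
    spin [x i] given the others, so every summand (a [residual]) is orthogonal to
    all functions that do not depend on [x i]. Hence the second moment of the
    score only involves its discrete derivatives, i.e. the changes of the score
    when a single spin is flipped ([score_sq_flip]). Symmetry and zero diagonals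
    express these changes through the local fields and the local interaction
    matrix ([contraction_flip]). A second-order expansion then bounds the second
    moment by a multiple of [N], given the fourth moment of the operator norm
    ([score_second_moment]); by Chebyshev's inequality the score is of order
    [sqrt N] at [beta].

    Steep: a configuration of energy below [eps * N] has Gibbs weight at most
    [exp (beta * eps * N) / (2 ^ N * Z)], so for small [eps] the energy exceeds
    [eps * N] with probability tending to one, as [Z] grows exponentially
    ([low_energy_prob]). The energy is [\sum_i x i * m i], whereas
    [\sum_i m i ^+ 2] is at most [N] times the squared operator norm. So the
    local fields of moderate size have squares summing to at least a constant
    times [N] ([moderate_entries_sum_sq]), and these make the score decrease in
    [b] at a rate of order [N] on bounded intervals ([sum_mtanh_increment]).

    On the event where both hold, the intermediate value theorem and monotonicity
    locate the smallest root ([mpl_near]). *)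

(** * The hyperbolic tangent *)

Section Tanh.
Context {R : realType}.
Implicit Types (x y a b B g : R).

(** The mean value theorem with the endpoints in either order; the bound on
    [c - a] is what a second-order estimate needs. *)
Lemma mean_value (f df : R -> R) : (forall x, is_derive x 1 f (df x)) ->
  forall a b, exists2 c, `|c - a| <= `|b - a| & f b - f a = df c * (b - a).
Proof.
move=> fdf a b.
have cf u v : {within `[u, v], continuous f}.
  apply: derivable_within_continuous => x _.
  by have /@ex_derive := fdf x.
have [ab|/ltW ba] := leP a b.
  have [c] := MVT_segment ab (fun x _ => fdf x) (cf a b).
  rewrite in_itv /= => /andP[ac cb] e; exists c => //.
  by rewrite !ger0_norm ?subr_ge0// lerB.
have [c] := MVT_segment ba (fun x _ => fdf x) (cf b a).
rewrite in_itv /= => /andP[bc ca] e; exists c.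
  by rewrite !ler0_norm ?subr_le0// !opprB lerB.
by rewrite -opprB e -mulrN opprB.
Qed.

Lemma cosh_gt0 x : 0 < expR x + expR (- x).
Proof. by rewrite addr_gt0 ?expR_gt0. Qed.

(** This is the odds ratio of a spin with mean [tanh u]; it turns the Gibbs
    weights into the conditional mean of a spin. *)
Lemma expR_tanh (u : R) :
  expR (2 * u) * (1 - tanh u) = 1 + tanh u.
Proof.
have c0 : expR u + expR (- u) != 0 by rewrite gt_eqF ?cosh_gt0.
have -> : 2 * u = u + u by ring.
have e1 : expR u * expR (- u) = 1 by rewrite -expRD subrr expR0.
rewrite expRD /tanh.
have -> : 1 - (expR u - expR (- u)) / (expR u + expR (- u)) =
  2 * expR (- u) / (expR u + expR (- u)) by field.
have -> : expR u * expR u * (2 * expR (- u) / (expR u + expR (- u))) =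
  2 * expR u * (expR u * expR (- u)) / (expR u + expR (- u)) by ring.
by rewrite e1; field.
Qed.

Lemma sechE x : 1 - tanh x ^+ 2 = 4 / (expR x + expR (- x)) ^+ 2.
Proof.
have c0 : expR x + expR (- x) != 0 by rewrite gt_eqF ?cosh_gt0.
have -> : 4 = 4 * (expR x * expR (- x)) by rewrite -expRD subrr expR0 mulr1.
by rewrite /tanh; field.
Qed.

Lemma sech_gt0 x : 0 < 1 - tanh x ^+ 2.
Proof. by rewrite sechE divr_gt0 // exprn_gt0 // cosh_gt0. Qed.

Lemma tanh_norm_le1 x : `|tanh x| <= 1.
Proof.
have := sech_gt0 x; rewrite subr_gt0 -real_normK ?num_real// => h.
by rewrite -(@expr_le1 _ 2%N) // ltW.
Qed.

Lemma sech_le1 x : 1 - tanh x ^+ 2 <= 1.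
Proof. by rewrite gerBl sqr_ge0. Qed.

(** The factor [1 - tanh x ^+ 2] decays like [4 * exp (- 2 * |x|)], and
    [4 * |x| <= (1 + |x|) ^+ 2 <= (exp x + exp (- x)) ^+ 2]. *)
Lemma norm_mul_sech x : `|x| * (1 - tanh x ^+ 2) <= 1.
Proof.
rewrite sechE mulrA ler_pdivrMr ?exprn_gt0 ?cosh_gt0// mul1r.
have h : 1 + `|x| <= expR x + expR (- x).
  case: (ger0P x) => _.
    by apply: le_trans (expR_ge1Dx x) _; rewrite lerDl expR_ge0.
  by apply: le_trans (expR_ge1Dx (- x)) _; rewrite lerDr expR_ge0.
apply: (@le_trans _ _ ((1 + `|x|) ^+ 2)).
  by have := sqr_ge0 (1 - `|x|); lra.
by rewrite ler_sqr ?nnegrE // ?addr_ge0// ?expR_ge0.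
Qed.

Lemma sech_lower B x : `|x| <= B -> expR (- (2 * B)) <= 1 - tanh x ^+ 2.
Proof.
rewrite ler_norml => /andP[h1 h2].
rewrite sechE expRN ler_pdivlMr ?exprn_gt0 ?cosh_gt0// mulrC.
rewrite ler_pdivrMr ?expR_gt0 //.
have -> : 4 * expR (2 * B) = (expR B + expR B) ^+ 2.
  have -> : 2 * B = B + B by ring.
  by rewrite expRD; ring.
rewrite ler_sqr ?nnegrE ?addr_ge0 ?expR_ge0//.
by rewrite lerD// ler_expR //; lra.
Qed.

Lemma is_derive_tanh x : is_derive x 1 (@tanh R) (1 - tanh x ^+ 2).
Proof.
have c0 : expR x + expR (- x) != 0 by rewrite gt_eqF ?cosh_gt0.
have -> : @tanh R = (fun x => expR x - expR (- x)) * (fun x => (expR x + expR (- x))^-1).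
  by apply/funext.
have hN : is_derive x 1 (fun x : R => expR (- x)) (- expR (- x)).
  have := @is_derive1_comp R expR -%R x _ _ (is_derive_expR (- x)) _.
  by move=> /(_ _ (is_deriveNid _ _)); rewrite mulrN1.
have hi : is_derive x 1 (fun x : R => (expR x + expR (- x))^-1)
   (- (expR x + expR (- x)) ^- 2 *: (expR x - expR (- x))).
  exact: is_deriveV.
apply: is_derive_eq.
rewrite /tanh /= /GRing.scale /= !opprK mulrfctE; field.
exact: c0.
Qed.

(** On a bounded interval the derivative of [tanh] is bounded away from zero. *)
Lemma tanh_incr_lower B a b : `|a| <= B -> `|b| <= B -> a <= b ->
  expR (- (2 * B)) * (b - a) <= tanh b - tanh a.
Proof.
move=> aB bB ab.
have cf : {within `[a, b], continuous (@tanh R)}.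
  apply: derivable_within_continuous => x _.
  by have /@ex_derive := is_derive_tanh x.
have [c] := MVT_segment ab (fun x _ => is_derive_tanh x) cf.
rewrite in_itv /= => /andP[ac cb] ->.
rewrite ler_wpM2r ?subr_ge0 // sech_lower //.
move: aB bB; rewrite !ler_norml => /andP[h1 h2] /andP[h3 h4].
by apply/andP; split; lra.
Qed.

Lemma tanh_le a b : a <= b -> tanh a <= tanh b.
Proof.
move=> ab; rewrite -subr_ge0.
apply: le_trans (@tanh_incr_lower (`|a| + `|b|) a b _ _ ab).
- by rewrite mulr_ge0 ?expR_ge0// subr_ge0.
- by rewrite lerDl.
- by rewrite lerDr.
Qed.

(** The contribution of a local field [x] to the pseudo-likelihood equation at
    the parameter [b] with [g = p * b], and its derivative in [x]. *)
Definition mtanh g x := x * tanh (g * x).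
Definition dmtanh g x := tanh (g * x) + g * x * (1 - tanh (g * x) ^+ 2).

Lemma is_derive_tanhM g x :
  is_derive x 1 (fun x => tanh (g * x)) (g * (1 - tanh (g * x) ^+ 2)).
Proof.
have h : is_derive x 1 (fun x => g * x) g.
  have := is_deriveZ g (is_derive_id x (1:R)).
  by rewrite /GRing.scale /= mulr1.
have := @is_derive1_comp R (@tanh R) (fun x => g * x) x _ _ (is_derive_tanh _) h.
by rewrite mulrC.
Qed.

(** The unbounded factor [x] is always multiplied by the derivative of [tanh],
    so all derivatives of [mtanh g] are bounded on the whole line. *)
Lemma dmtanh_le g x : `|dmtanh g x| <= 2.
Proof.
rewrite /dmtanh (le_trans (ler_normD _ _))//.
have -> : 2 = 1 + 1 :> R by [].
apply: lerD; first exact: tanh_norm_le1.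
rewrite normrM [`|1 - _|]ger0_norm ?norm_mul_sech //.
exact/ltW/sech_gt0.
Qed.

Lemma is_derive_mtanh g x : is_derive x 1 (mtanh g) (dmtanh g x).
Proof.
have := is_deriveM (is_derive_id x (1 : R)) (is_derive_tanhM g x).
rewrite /GRing.scale /= => h; apply: (is_derive_eq h).
by rewrite /dmtanh; ring.
Qed.

Lemma is_derive_dmtanh g x : is_derive x 1 (dmtanh g)
  (2 * g * (1 - tanh (g * x) ^+ 2) -
   2 * g * (tanh (g * x) * (g * x * (1 - tanh (g * x) ^+ 2)))).
Proof.
have h1 := is_derive_tanhM g x.
have h : is_derive x 1 (fun x => g * x) g.
  have := is_deriveZ g (is_derive_id x (1:R)).
  by rewrite /GRing.scale /= mulr1.
have h2 := is_deriveB (is_derive_cst (1:R) x 1) (is_deriveX 2 h1).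
have h3 := is_deriveD h1 (is_deriveM h h2).
apply: (is_derive_eq h3).
rewrite /GRing.scale /= !fctE; ring.
Qed.

Lemma dmtanh_lip g x y : 0 <= g -> `|dmtanh g y - dmtanh g x| <= 4 * g * `|y - x|.
Proof.
move=> g0; have [c _ ->] := mean_value (is_derive_dmtanh g) x y.
rewrite normrM ler_wpM2r // (le_trans (ler_normB _ _))//.
have -> : 4 * g = 2 * g + 2 * g by ring.
have g2 : 0 <= 2 * g by rewrite mulr_ge0.
apply: lerD; rewrite normrM (ger0_norm g2) ler_piMr//.
  by rewrite ger0_norm ?sech_le1// ltW ?sech_gt0.
rewrite normrM mulr_ile1//; first exact: tanh_norm_le1.
rewrite normrM [`|1 - _|]ger0_norm ?norm_mul_sech //.
exact/ltW/sech_gt0.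
Qed.

(** A first-order bound on the increments would not suffice for the score: its
    intermediate points depend on the flipped site, and only the linear term
    evaluated at a common point can be seen as a matrix-vector product. *)
Lemma mtanh_taylor g x y : 0 <= g ->
  `|mtanh g y - mtanh g x - dmtanh g x * (y - x)| <= 4 * g * (y - x) ^+ 2.
Proof.
move=> g0; have [c cx ->] := mean_value (is_derive_mtanh g) x y.
rewrite -mulrBl normrM -[leRHS]mulrA -[(y - x) ^+ 2]real_normK ?num_real//.
rewrite expr2 [leRHS]mulrA [leRHS]mulrA ler_wpM2r// (le_trans (dmtanh_lip _ _ g0))//.
by rewrite ler_wpM2l // mulr_ge0.
Qed.

End Tanh.

(** * Contractions of a symmetric tensor with spins *)

Section Contraction.
Context {R : realType} {p N : nat}.
Implicit Types (J : tensor R p N) (x : config N) (s : seq 'I_N) (i : 'I_N).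

(** The Hamiltonian, the local fields and the local interaction matrix are the
    contractions with [s] of length 0, 1 and 2, so that each identity below
    serves for two of them. *)
Definition contraction J s x : R :=
  \sum_(t : p.-tuple 'I_N | take (size s) t == s)
    J t * \prod_(k <- drop (size s) t) spin R x k.

Definition flip i x : config N := [ffun k => x k (+) (k == i)].

Lemma flipK i : involutive (flip i).
Proof. by move=> x; apply/ffunP => k; rewrite !ffunE -addbA addbb addbF. Qed.

Lemma spin_flip i x k : spin R (flip i x) k = (-1) ^+ (k == i) * spin R x k.
Proof. by rewrite /spin ffunE signr_addb mulrC. Qed.

Lemma spin_sq x i : spin R x i * spin R x i = 1.
Proof. by rewrite /spin -expr2 sqrr_sign. Qed.

Lemma spin_norm x i : `|spin R x i| = 1.
Proof. by rewrite /spin normrX normrN1 expr1n. Qed.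

Lemma hamiltonian_contraction J x : hamiltonian J x = contraction J [::] x.
Proof.
rewrite /hamiltonian /contraction; apply: eq_big => [t|t _] /=.
  by rewrite take0.
by rewrite drop0.
Qed.

Lemma local_field_contraction J x i : local_field J x i = contraction J [:: i] x.
Proof. by []. Qed.

Lemma local_interaction_contraction J x i j :
  local_interaction J x i j = contraction J [:: i; j] x.
Proof. by rewrite mxE. Qed.

Lemma nth_ordinal q (t : p.-tuple 'I_N) (hq : (q < p)%N) i :
  nth i t q = tnth t (Ordinal hq).
Proof. by rewrite (tnth_nth i). Qed.

Lemma take_tuple_rcons s i (t : p.-tuple 'I_N) (hs : (size s < p)%N) :
  (take (size (rcons s i)) t == rcons s i) =
  (take (size s) t == s) && (tnth t (Ordinal hs) == i).
Proof.
rewrite size_rcons (take_nth (tnth t (Ordinal hs))) ?size_tuple//.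
by rewrite eqseq_rcons nth_ordinal.
Qed.

(** Prescribing the entry that follows [s] takes its spin out of the product. *)
Lemma contraction_rcons J s x i (hs : (size s < p)%N) :
  \sum_(t : p.-tuple 'I_N | (take (size s) t == s) && (tnth t (Ordinal hs) == i))
    J t * \prod_(k <- drop (size s) t) spin R x k
  = spin R x i * contraction J (rcons s i) x.
Proof.
rewrite /contraction big_distrr /=; apply: eq_big => [t|t /andP[_ /eqP ti]].
  by rewrite (take_tuple_rcons _ _ hs).
rewrite size_rcons (drop_nth (tnth t (Ordinal hs))) ?size_tuple//.
by rewrite big_cons nth_ordinal ti mulrCA.
Qed.

Lemma contraction_expand J s x : (size s < p)%N ->
  contraction J s x = \sum_i spin R x i * contraction J (rcons s i) x.
Proof.
move=> hs; rewrite {1}/contraction.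
rewrite (partition_big (fun t : p.-tuple 'I_N => tnth t (Ordinal hs)) xpredT)//=.
by apply: eq_bigr => i _; rewrite contraction_rcons.
Qed.

Lemma prod_drop q (t : p.-tuple 'I_N) (F : 'I_N -> R) :
  \prod_(k <- drop q t) F k = \prod_(l < p | (q <= l)%N) F (tnth t l).
Proof.
case: p t => [|p'] t.
  by rewrite big_ord0 tuple0 /= big_nil.
pose x0 := tnth t ord0.
rewrite (big_nth x0) size_drop size_tuple.
under eq_bigr do rewrite nth_drop.
under eq_bigr do rewrite addnC.
rewrite -(big_addn 0 p'.+1 q xpredT (fun j : nat => F (nth x0 t j))) add0n.
rewrite big_geq_mkord; apply: eq_bigr => l _.
by rewrite (tnth_nth x0).
Qed.

Definition permute_tuple (sg : 'S_p) (t : p.-tuple 'I_N) : p.-tuple 'I_N :=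
  [tuple tnth t (sg k) | k < p].

(** A tuple on which [J] does not vanish has distinct entries, so at most one of
    them is [i]: flipping the spin at [i] either fixes the monomial or changes
    its sign. *)
Lemma prod_flip J q i x (t : p.-tuple 'I_N) : zero_diagonal J ->
  J t * \prod_(k <- drop q t) spin R x k
  - J t * \prod_(k <- drop q t) spin R (flip i x) k =
  \sum_(l < p | (q <= l)%N && (tnth t l == i))
    2 * (J t * \prod_(k <- drop q t) spin R x k).
Proof.
move=> J0; have [->|Jt] := eqVneq (J t) 0.
  by rewrite !mul0r mulr0 subrr sumr_const mul0rn.
have tinj : injective (tnth t).
  move=> k l e; apply/val_inj; have [kl|lk|//] := ltngtP (val k) (val l).
    by have := J0 t k l kl e; move/eqP: Jt.
  by have := J0 t l k lk (esym e); move/eqP: Jt.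
rewrite !prod_drop.
case: (pickP (fun l : 'I_p => (q <= l)%N && (tnth t l == i))) => [l /andP[ql /eqP tl]|h].
  rewrite [RHS](big_pred1 l); last first.
    move=> k; rewrite /= -tl (inj_eq tinj); case: eqVneq => [->|_]; by rewrite ?ql ?andbF.
  rewrite [X in _ - _ * X](bigD1 l)//= spin_flip tl eqxx expr1 -tl.
  rewrite [X in _ - _ * (_ * X)](eq_bigr (fun l => spin R x (tnth t l))); last first.
    move=> k /andP[_ kl]; rewrite spin_flip (inj_eq tinj) (negPf kl).
    by rewrite expr0 mul1r.
  rewrite mulN1r mulNr mulrN opprK (bigD1 l)//=; ring.
rewrite [RHS]big_pred0 // [X in _ * _ - _ * X](eq_bigr (fun l => spin R x (tnth t l))).
  by rewrite subrr.
move=> k qk; rewrite spin_flip; have := h k; rewrite qk /= => ->.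
by rewrite expr0 mul1r.
Qed.

(** Exchanging the entries at positions [size s] and [l] leaves the prefix, the
    value of [J] and the monomial unchanged. *)
Lemma sum_entry_swap J s i x (hs : (size s < p)%N) (l : 'I_p) :
  symmetric_tensor J -> (size s <= l)%N ->
  \sum_(t : p.-tuple 'I_N | (take (size s) t == s) && (tnth t l == i))
    J t * \prod_(k <- drop (size s) t) spin R x k =
  \sum_(t : p.-tuple 'I_N | (take (size s) t == s) && (tnth t (Ordinal hs) == i))
    J t * \prod_(k <- drop (size s) t) spin R x k.
Proof.
move=> Jsym sl.
pose sg := tperm (Ordinal hs) l.
have sgK : involutive (permute_tuple sg).
  move=> t; apply: eq_from_tnth => k.
  by rewrite !tnth_mktuple tpermK.
rewrite (reindex_inj (inv_inj sgK)).
apply: eq_big => [t|t _].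
  rewrite tnth_mktuple tpermR; congr (_ && _).
  suff -> : take (size s) (permute_tuple sg t) = take (size s) t by [].
  apply: (@eq_from_nth _ i); first by rewrite !size_take !size_tuple.
  move=> j; rewrite size_take size_tuple hs => js.
  rewrite !nth_take //.
  have jp : (j < p)%N := ltn_trans js hs.
  rewrite !(nth_ordinal _ jp) tnth_mktuple tpermD//.
    by rewrite -val_eqE /= gtn_eqF.
  by rewrite -val_eqE /= gtn_eqF // (leq_trans js).
rewrite Jsym !prod_drop; congr (_ * _).
rewrite [RHS](reindex_inj (@perm_inj _ sg)) /=.
apply: eq_big => [k|k _]; last by rewrite tnth_mktuple.
by rewrite /sg; case: tpermP => [->|->|//] /=; rewrite ?sl leqnn.
Qed.

(** The discrete derivative in the spin [i]: each of the [p - size s] free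
    positions may carry [i], and by symmetry all contribute equally. *)
Lemma contraction_flip J s i x : symmetric_tensor J -> zero_diagonal J ->
  (size s < p)%N ->
  contraction J s x - contraction J s (flip i x) =
  2 * (p - size s)%:R * (spin R x i * contraction J (rcons s i) x).
Proof.
move=> Jsym J0 hs; rewrite {1 2}/contraction -sumrB.
under eq_bigr do rewrite (prod_flip _ _ _ _ J0).
rewrite (exchange_big_dep (fun l : 'I_p => (size s <= l)%N)) /=; last first.
  by move=> t l _ /andP[].
rewrite (eq_bigr (fun=> 2 * (spin R x i * contraction J (rcons s i) x))).
  rewrite sumr_const -[LHS]mulr_natr.
  suff -> : #|[pred l : 'I_p | (size s <= l)%N]| = (p - size s)%N by ring.
  rewrite -sum1_card -(big_geq_mkord _ _ xpredT (fun=> 1%N)) /=.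
  by rewrite sum_nat_const_nat muln1.
move=> l sl; rewrite -(contraction_rcons _ _ _ hs) -(sum_entry_swap _ _ hs Jsym sl).
rewrite big_distrr /=; apply: eq_bigl => t.
by rewrite sl.
Qed.

Lemma contraction_diag J i x : (1 < p)%N -> zero_diagonal J ->
  contraction J [:: i; i] x = 0.
Proof.
move=> p1 J0; apply: big1 => t /eqP /= h.
have p0 : (0 < p)%N := ltnW p1.
rewrite (J0 t (Ordinal p0) (Ordinal p1)) ?mul0r//.
have e j (hj : (j < 2)%N) (jp : (j < p)%N) : tnth t (Ordinal jp) = i.
  rewrite -(nth_ordinal _ _ i) -(nth_take i hj) h.
  by case: j hj {jp} => [|[]].
by rewrite !e.
Qed.

End Contraction.

(** * The Euclidean operator norm *)

Section OperatorNorm.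
Context {R : realType}.

Lemma cauchy_schwarz (I : finType) (a b : I -> R) :
  (\sum_i a i * b i) ^+ 2 <= (\sum_i a i ^+ 2) * (\sum_i b i ^+ 2).
Proof.
set C := \sum_i a i * b i; set A := \sum_i a i ^+ 2; set B := \sum_i b i ^+ 2.
have B0 : 0 <= B by apply: sumr_ge0 => i _; exact: sqr_ge0.
have key : 0 <= B * (A * B - C ^+ 2).
  have -> : B * (A * B - C ^+ 2) = \sum_i (B * a i - C * b i) ^+ 2.
    under eq_bigr => i _.
      have -> : (B * a i - C * b i) ^+ 2 =
        B ^+ 2 * a i ^+ 2 - 2 * B * C * (a i * b i) + C ^+ 2 * b i ^+ 2 by ring.
      over.
    by rewrite big_split sumrB /= -!mulr_sumr -/A -/B -/C; ring.
  by apply: sumr_ge0 => i _; exact: sqr_ge0.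
have [B_gt0|B_le0] := ltP 0 B; first by rewrite -subr_ge0 -(pmulr_rge0 _ B_gt0).
have /eqP B00 : B == 0 by rewrite eq_le B_le0 B0.
have b0 i : b i = 0.
  move/eqP: B00; rewrite psumr_eq0 => [|j _]; last exact: sqr_ge0.
  by move=> /allP/(_ i); rewrite mem_index_enum /= sqrf_eq0 => /(_ isT) /eqP.
have -> : C = 0 by apply: big1 => i _; rewrite b0 mulr0.
by rewrite B00 expr0n mulr0.
Qed.

Lemma cauchy_schwarz_le (I : finType) (a b : I -> R) (u v : R) :
  0 <= u -> 0 <= v ->
  \sum_i a i ^+ 2 <= u ^+ 2 -> \sum_i b i ^+ 2 <= v ^+ 2 ->
  `|\sum_i a i * b i| <= u * v.
Proof.
move=> u0 v0 au bv.
rewrite -(@ler_pXn2r _ 2)// ?nnegrE ?mulr_ge0// real_normK ?num_real// exprMn.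
apply: le_trans (cauchy_schwarz a b) _.
by apply: ler_pM => //; apply: sumr_ge0 => i _; exact: sqr_ge0.
Qed.

Context {n : nat}.
Implicit Types (A : 'M[R]_n) (u : 'cV[R]_n).

Lemma l2norm_ge0 u : 0 <= l2norm u.
Proof. exact: sqrtr_ge0. Qed.

Lemma l2norm_sq u : l2norm u ^+ 2 = \sum_i u i 0 ^+ 2.
Proof. by rewrite sqr_sqrtr// sumr_ge0// => i _; exact: sqr_ge0. Qed.

Lemma l2normZ (c : R) u : l2norm (c *: u) = `|c| * l2norm u.
Proof.
rewrite /l2norm -sqrtr_sqr -sqrtrM ?sqr_ge0//; congr Num.sqrt.
by rewrite mulr_sumr; apply: eq_bigr => i _; rewrite mxE exprMn.
Qed.

Lemma l2norm0 : l2norm (0 : 'cV[R]_n) = 0.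
Proof. by rewrite -(scale0r (0 : 'cV[R]_n)) l2normZ normr0 mul0r. Qed.

(** The operator norm is a supremum; the Frobenius norm shows that the set it is
    taken over is bounded. *)
Lemma l2norm_mulmx_frobenius A u :
  l2norm (A *m u) <= Num.sqrt (\sum_i \sum_j A i j ^+ 2) * l2norm u.
Proof.
have F0 : 0 <= \sum_i \sum_j A i j ^+ 2.
  by apply: sumr_ge0 => i _; apply: sumr_ge0 => j _; exact: sqr_ge0.
rewrite /l2norm -sqrtrM //; apply: ler_wsqrtr.
rewrite mulr_suml; apply: ler_sum => i _; rewrite mxE.
exact: cauchy_schwarz.
Qed.

Lemma opnorm_ub A u : l2norm u <= 1 -> l2norm (A *m u) <= opnorm A.
Proof.
move=> u1; apply: ub_le_sup; last by exists u.
exists (Num.sqrt (\sum_i \sum_j A i j ^+ 2)) => _ [v /= v1 <-].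
by apply: le_trans (l2norm_mulmx_frobenius A v) _; rewrite ler_piMr ?sqrtr_ge0.
Qed.

Lemma opnorm_ge0 A : 0 <= opnorm A.
Proof.
by have := @opnorm_ub A 0; rewrite mulmx0 l2norm0; apply; exact: ler01.
Qed.

Lemma opnormP A u : l2norm (A *m u) <= opnorm A * l2norm u.
Proof.
have [u0|] := ltP 0 (l2norm u).
  have := @opnorm_ub A ((l2norm u)^-1 *: u).
  rewrite -scalemxAr !l2normZ ger0_norm ?invr_ge0 ?l2norm_ge0// mulVf ?gt_eqF//.
  by move=> /(_ (lexx _)); rewrite mulrC ler_pdivrMr.
move=> ule; have u0 : l2norm u = 0 by apply/eqP; rewrite eq_le ule l2norm_ge0.
by apply: le_trans (l2norm_mulmx_frobenius A u) _; rewrite u0 !mulr0.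
Qed.

Lemma opnorm_sum_sq A (v : 'I_n -> R) :
  \sum_i (\sum_j A i j * v j) ^+ 2 <= opnorm A ^+ 2 * \sum_j v j ^+ 2.
Proof.
have := opnormP A (\col_j v j).
rewrite -(@ler_pXn2r _ 2)// ?nnegrE ?mulr_ge0 ?l2norm_ge0 ?opnorm_ge0//.
rewrite exprMn !l2norm_sq.
under eq_bigr do (rewrite mxE; under eq_bigr do rewrite mxE).
by under [X in _ <= _ * X]eq_bigr do rewrite mxE.
Qed.

(** The image of a unit coordinate vector has norm at most [opnorm A]. *)
Lemma opnorm_col_sum_sq A j : \sum_i A i j ^+ 2 <= opnorm A ^+ 2.
Proof.
have := opnorm_sum_sq A (fun k => (k == j)%:R).
have -> : \sum_k (k == j)%:R ^+ 2 = 1 :> R.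
  rewrite (bigD1 j)//= eqxx expr1n big1 ?addr0// => k /negPf ->.
  by rewrite expr0n.
rewrite mulr1; congr (_ <= _); apply: eq_bigr => i _; congr (_ ^+ 2).
rewrite (bigD1 j)//= eqxx mulr1 big1 ?addr0// => k /negPf ->.
by rewrite mulr0.
Qed.

End OperatorNorm.

(** * The Ising measure *)

Section IsingMeasure.
Context {R : realType} {p N : nat}.
Variables (J : tensor R p N) (beta : R).
Implicit Types (x : config N) (i j : 'I_N).

Lemma sum_expR_gt0 : 0 < \sum_(x : config N) expR (beta * hamiltonian J x).
Proof.
rewrite (bigD1 [ffun=> false])//= ltr_wpDr ?expR_gt0//.
by apply: sumr_ge0 => x _; exact: expR_ge0.
Qed.

Lemma partition_function_gt0 : 0 < partition_function J beta.
Proof. by rewrite mulr_gt0 ?sum_expR_gt0// invr_gt0 exprn_gt0. Qed.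

Lemma ising_gt0 x : 0 < ising J beta x.
Proof.
by rewrite divr_gt0 ?expR_gt0// mulr_gt0 ?partition_function_gt0// exprn_gt0.
Qed.

Lemma ising_sum1 : \sum_x ising J beta x = 1.
Proof.
rewrite /ising -mulr_suml /partition_function mulrA mulfV ?expf_neq0// mul1r.
by rewrite divff// gt_eqF// sum_expR_gt0.
Qed.

Lemma ising_expectation_le (f g : config N -> R) : (forall x, f x <= g x) ->
  ising_expectation J beta f <= ising_expectation J beta g.
Proof. by move=> fg; apply: ler_sum => x _; rewrite ler_pM2l// ising_gt0. Qed.

Lemma ising_expectationD (f g : config N -> R) :
  ising_expectation J beta (fun x => f x + g x) =
  ising_expectation J beta f + ising_expectation J beta g.
Proof. by rewrite -big_split; apply: eq_bigr => x _; rewrite mulrDr. Qed.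

Lemma ising_expectationZ (c : R) (f : config N -> R) :
  ising_expectation J beta (fun x => c * f x) = c * ising_expectation J beta f.
Proof. by rewrite mulr_sumr; apply: eq_bigr => x _; rewrite mulrCA. Qed.

Lemma ising_expectation_sum (I : finType) (f : I -> config N -> R) :
  ising_expectation J beta (fun x => \sum_i f i x) =
  \sum_i ising_expectation J beta (f i).
Proof. by rewrite exchange_big; apply: eq_bigr => x _; rewrite mulr_sumr. Qed.

Lemma ising_expectation1 : ising_expectation J beta (fun=> 1) = 1.
Proof. by rewrite -[RHS]ising_sum1; apply: eq_bigr => x _; rewrite mulr1. Qed.

Lemma ising_probE (A : set (config N)) :
  ising_prob J beta A = ising_expectation J beta (fun x => (x \in A)%:R).
Proof.
rewrite /ising_prob big_mkcond; apply: eq_bigr => x _.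
by case: ifP => _; rewrite ?mulr1 ?mulr0.
Qed.

(** On this event each Gibbs weight is at most [exp (beta * e)], and there are
    only [2 ^ N] configurations. *)
Lemma low_energy_prob (e : R) : 0 <= beta ->
  ising_expectation J beta (fun x => (hamiltonian J x < e)%R%:R) <=
  expR (beta * e - log_partition J beta).
Proof.
move=> b0; have Z0 := partition_function_gt0.
rewrite expRD expRN /log_partition lnK ?posrE//.
have -> : expR (beta * e) / partition_function J beta =
    \sum_(x : config N) expR (beta * e) / (2 ^+ N * partition_function J beta).
  rewrite sumr_const card_ffun card_bool card_ord -[RHS]mulr_natl natrX.
  by field; rewrite expf_neq0 ?gt_eqF.
apply: ler_sum => x _; rewrite /ising mulrAC ler_wpM2r//.
  by rewrite invr_ge0 mulr_ge0 ?exprn_ge0// ltW.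
have [h|_] := ltP; last by rewrite mulr0 expR_ge0.
by rewrite mulr1 ler_expR ler_wpM2l// ltW.
Qed.

End IsingMeasure.

(** * The second moment of the score *)

Section Score.
Context {R : realType} {p N : nat}.
Variables (J : tensor R p N) (beta : R).
Hypotheses (hp : (2 <= p)%N) (Jsym : symmetric_tensor J)
  (Jdiag : zero_diagonal J).
Implicit Types (x : config N) (i j : 'I_N).

Local Notation m := (local_field J).
Local Notation E := (ising_expectation J beta).

Lemma hamiltonian_local_field x :
  hamiltonian J x = \sum_i spin R x i * m x i.
Proof.
by rewrite hamiltonian_contraction contraction_expand ?(ltn_trans _ hp).
Qed.

Lemma local_field_mulmx x i :
  m x i = \sum_j local_interaction J x i j * spin R x j.
Proof.
rewrite local_field_contraction contraction_expand//.
by apply: eq_bigr => j _; rewrite local_interaction_contraction mulrC.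
Qed.

(** The vector of local fields is the local interaction matrix applied to the
    spin vector, whose squared norm is [N]. *)
Lemma local_field_sum_sq x :
  \sum_i m x i ^+ 2 <= (opnorm (local_interaction J x)) ^+ 2 * N%:R.
Proof.
under eq_bigr do rewrite local_field_mulmx.
apply: le_trans (opnorm_sum_sq _ _) _.
under eq_bigr do rewrite expr2 spin_sq.
by rewrite sumr_const card_ord.
Qed.

Lemma hamiltonian_flip x i :
  hamiltonian J x - hamiltonian J (flip i x) = 2 * p%:R * (spin R x i * m x i).
Proof.
by rewrite !hamiltonian_contraction contraction_flip ?(ltn_trans _ hp)//= subn0.
Qed.

Lemma local_field_flip x i j :
  m x j - m (flip i x) j =
  2 * (p - 1)%:R * (spin R x i * local_interaction J x j i).
Proof.
by rewrite !local_field_contraction contraction_flip// local_interaction_contraction.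
Qed.

(** A local field does not feel its own spin, because [J] has zero diagonals. *)
Lemma local_field_flip_id x i : m (flip i x) i = m x i.
Proof.
apply/esym/eqP; rewrite -subr_eq0 local_field_flip local_interaction_contraction.
by rewrite contraction_diag// !mulr0.
Qed.

(** The conditional mean of the spin at [i] given all others is
    [tanh (p * beta * m x i)], so a residual is conditionally centred. *)
Definition residual i x : R :=
  m x i * (spin R x i - tanh (p%:R * beta * m x i)).

(** Up to a positive constant, the derivative of the log pseudo-likelihood at
    the true parameter; its zero in the parameter is the estimate. *)
Definition score x : R := \sum_i residual i x.

Lemma scoreE x : score x =
  hamiltonian J x - \sum_i mtanh (p%:R * beta) (m x i).
Proof.
rewrite hamiltonian_local_field -sumrB; apply: eq_bigr => i _.
by rewrite /residual /mtanh mulrBr [spin R x i * _]mulrC.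
Qed.

(** The two configurations that differ at [i] have Gibbs weights in the ratio
    [exp (2 * p * beta * spin x i * m x i)], which [expR_tanh] balances exactly
    against the two values of the residual. *)
Lemma ising_residual_flip i x :
  ising J beta (flip i x) * residual i (flip i x) =
  - (ising J beta x * residual i x).
Proof.
rewrite /residual local_field_flip_id spin_flip eqxx expr1 mulN1r /ising.
set Z := 2 ^+ N * _; set t := tanh _.
suff h : expR (beta * hamiltonian J (flip i x)) * (- spin R x i - t) =
    - (expR (beta * hamiltonian J x) * (spin R x i - t)).
  have -> : expR (beta * hamiltonian J (flip i x)) / Z *
       (m x i * (- spin R x i - t)) =
     expR (beta * hamiltonian J (flip i x)) * (- spin R x i - t) * (m x i / Z).
    by ring.
  by rewrite h; ring.
have -> : hamiltonian J (flip i x) =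
   hamiltonian J x - 2 * p%:R * (spin R x i * m x i).
  by rewrite -hamiltonian_flip; ring.
have := expR_tanh (p%:R * beta * m x i); rewrite -/t => ht.
rewrite /spin; case: (x i) => /=; rewrite ?expr1 ?expr0.
- have -> : beta * (hamiltonian J x - 2 * p%:R * (-1 * m x i)) =
    beta * hamiltonian J x + 2 * (p%:R * beta * m x i) by ring.
  by rewrite expRD opprK -[_ * expR _ * _]mulrA ht; ring.
- have -> : beta * hamiltonian J x =
    beta * (hamiltonian J x - 2 * p%:R * (1 * m x i)) +
    2 * (p%:R * beta * m x i) by ring.
  rewrite expRD -[_ * expR _ * _]mulrA ht; ring.
Qed.

Lemma residual_orthogonal i (h : config N -> R) :
  (forall x, h (flip i x) = h x) -> E (fun x => residual i x * h x) = 0.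
Proof.
move=> hh.
have : E (fun x => residual i x * h x) = - E (fun x => residual i x * h x).
  rewrite {1}/ising_expectation (reindex_inj (inv_inj (@flipK _ i)))/=.
  rewrite -sumrN; apply: eq_bigr => x _.
  by rewrite hh mulrA ising_residual_flip mulNr mulrA.
by move/eqP; rewrite -subr_eq0 opprK -mulr2n mulrn_eq0 => /eqP.
Qed.

(** In each product [residual i x * score x], the part of the score that is
    invariant under the flip at [i] is orthogonal to the residual; what remains
    is half of the discrete derivative of the score. *)
Lemma score_sq_flip :
  E (fun x => score x ^+ 2) =
  E (fun x => \sum_i residual i x * ((score x - score (flip i x)) / 2)).
Proof.
have -> : E (fun x => score x ^+ 2) =
    E (fun x => \sum_i residual i x * score x).
  by apply: eq_bigr => x _; rewrite -mulr_suml expr2.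
rewrite !ising_expectation_sum; apply: eq_bigr => i _.
rewrite -[RHS]addr0 -(@residual_orthogonal i (fun x => (score x + score (flip i x)) / 2)).
  rewrite -ising_expectationD; apply: eq_bigr => x _; congr (_ * _).
  by field.
by move=> x; rewrite flipK addrC.
Qed.

Lemma residual_sum_sq x :
  \sum_i residual i x ^+ 2 <=
  (2 * opnorm (local_interaction J x) * Num.sqrt N%:R) ^+ 2.
Proof.
rewrite !exprMn sqr_sqrtr// -mulrA.
apply: (@le_trans _ _ (2 ^+ 2 * \sum_i m x i ^+ 2)); last first.
  by rewrite ler_wpM2l ?exprn_ge0// local_field_sum_sq.
rewrite mulr_sumr; apply: ler_sum => i _.
rewrite /residual exprMn mulrC ler_wpM2r ?sqr_ge0//.
rewrite -real_normK ?num_real// lerXn2r ?nnegrE//.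
apply: le_trans (ler_normB _ _) _; rewrite spin_norm.
by have := tanh_norm_le1 (p%:R * beta * m x i); lra.
Qed.

(** Expanding the discrete derivative of the score gives three sums over sites.
    The one from the Hamiltonian is an inner product of residuals and local
    fields; the linear part of the [tanh] terms is a bilinear form in the local
    interaction matrix; the quadratic remainders are controlled by the norms of
    its columns. Each is of order [N] when [K] is bounded. *)
Lemma score_flip_sum_le x : 0 <= beta ->
  let K := opnorm (local_interaction J x) in
  `|\sum_i residual i x * (score x - score (flip i x))| <=
  N%:R * (12 * p%:R * K ^+ 2 + 32 * p%:R ^+ 3 * beta * K ^+ 3).
Proof.
move=> b0; cbv zeta; set K := opnorm _.
have K0 : 0 <= K := opnorm_ge0 _.
pose s : R := Num.sqrt N%:R.
have s0 : 0 <= s := sqrtr_ge0 _.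
have sN : s ^+ 2 = N%:R by rewrite sqr_sqrtr.
pose g := p%:R * beta.
have g0 : 0 <= g by rewrite mulr_ge0.
pose q : R := (p - 1)%:R.
have q0 : 0 <= q by rewrite ler0n.
have qp : q <= p%:R by rewrite ler_nat leq_subr.
have rK := residual_sum_sq x; rewrite -/K -/s in rK.
(* The second-order remainder of the change of the j-th term. *)
pose e i j := mtanh g (m (flip i x) j) - mtanh g (m x j)
    - dmtanh g (m x j) * (m (flip i x) j - m x j).
have eE i j : mtanh g (m (flip i x) j) - mtanh g (m x j) =
    e i j - 2 * q * (dmtanh g (m x j) * (spin R x i * local_interaction J x j i)).
  have h := local_field_flip x i j; rewrite -/q in h.
  rewrite /e -[m (flip i x) j - m x j]opprB h; ring.
have dS i : score x - score (flip i x) = 2 * p%:R * (spin R x i * m x i)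
    + (\sum_j e i j) - 2 * q * \sum_j dmtanh g (m x j) *
         (spin R x i * local_interaction J x j i).
  have -> : score x - score (flip i x) =
     (hamiltonian J x - hamiltonian J (flip i x)) +
     (\sum_j (mtanh g (m (flip i x) j) - mtanh g (m x j))).
    by rewrite !scoreE sumrB -/g; ring.
  rewrite hamiltonian_flip -addrA; congr (_ + _).
  by rewrite mulr_sumr -sumrB; apply: eq_bigr => j _; rewrite eE.
have -> : \sum_i residual i x * (score x - score (flip i x)) =
   2 * p%:R * (\sum_i residual i x * (spin R x i * m x i))
   + \sum_i residual i x * (\sum_j e i j)
   - 2 * q * (\sum_j dmtanh g (m x j) *
        \sum_i local_interaction J x j i * (spin R x i * residual i x)).
  have -> : \sum_j dmtanh g (m x j) *
        (\sum_i local_interaction J x j i * (spin R x i * residual i x)) =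
      \sum_i residual i x * \sum_j dmtanh g (m x j) *
         (spin R x i * local_interaction J x j i).
    under eq_bigr do rewrite mulr_sumr.
    rewrite exchange_big; apply: eq_bigr => i _; rewrite mulr_sumr.
    by apply: eq_bigr => j _; ring.
  rewrite !mulr_sumr -big_split -sumrB; apply: eq_bigr => i _ /=.
  by rewrite dS; ring.
have T1 : `|\sum_i residual i x * (spin R x i * m x i)| <= (2 * K * s) * (K * s).
  apply: cauchy_schwarz_le => //; rewrite ?mulr_ge0//.
  rewrite exprMn sN; apply: le_trans (local_field_sum_sq x).
  by apply: ler_sum => i _; rewrite exprMn [spin _ _ _ ^+ 2]expr2 spin_sq mul1r.
have T3 : `|\sum_j dmtanh g (m x j) *
        \sum_i local_interaction J x j i * (spin R x i * residual i x)|
    <= (2 * s) * (K * (2 * K * s)).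
  apply: cauchy_schwarz_le; rewrite ?mulr_ge0//.
    rewrite exprMn sN; apply: (@le_trans _ _ (\sum_(j < N) 2 ^+ 2)).
      apply: ler_sum => j _; rewrite -real_normK ?num_real// lerXn2r ?nnegrE//.
      exact: dmtanh_le.
    by rewrite sumr_const card_ord mulr_natr.
  rewrite exprMn; apply: le_trans (opnorm_sum_sq _ _) _.
  rewrite ler_wpM2l ?sqr_ge0//; apply: le_trans rK.
  by apply: ler_sum => i _; rewrite exprMn [spin _ _ _ ^+ 2]expr2 spin_sq mul1r.
have eb i : `|\sum_j e i j| <= 16 * g * p%:R ^+ 2 * K ^+ 2.
  apply: le_trans (ler_norm_sum _ _ _) _.
  apply: (@le_trans _ _ (\sum_j 16 * g * p%:R ^+ 2 * local_interaction J x j i ^+ 2)).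
    apply: ler_sum => j _; apply: le_trans (mtanh_taylor _ _ g0) _.
    rewrite -[m (flip i x) j - m x j]opprB sqrrN local_field_flip -/q.
    rewrite !exprMn [spin _ _ _ ^+ 2]expr2 spin_sq mul1r.
    have -> : 4 * g * (2 ^+ 2 * q ^+ 2 * local_interaction J x j i ^+ 2) =
       16 * g * q ^+ 2 * local_interaction J x j i ^+ 2 by ring.
    rewrite ler_wpM2r ?sqr_ge0// ler_wpM2l ?mulr_ge0//.
    by rewrite lerXn2r ?nnegrE.
  rewrite -mulr_sumr ler_wpM2l ?opnorm_col_sum_sq//.
  by rewrite !mulr_ge0// exprn_ge0.
have T2 : `|\sum_i residual i x * (\sum_j e i j)| <=
    (2 * K * s) * ((16 * g * p%:R ^+ 2 * K ^+ 2) * s).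
  apply: cauchy_schwarz_le => //; rewrite ?mulr_ge0 ?exprn_ge0//.
  rewrite exprMn sN.
  apply: (@le_trans _ _ (\sum_(i < N) (16 * g * p%:R ^+ 2 * K ^+ 2) ^+ 2)).
    apply: ler_sum => i _; rewrite -real_normK ?num_real// lerXn2r ?nnegrE//.
    by rewrite ?mulr_ge0 ?exprn_ge0//.
  by rewrite sumr_const card_ord mulr_natr.
apply: le_trans (ler_normB _ _) _.
apply: (@le_trans _ _ (2 * p%:R * ((2 * K * s) * (K * s)) +
  (2 * K * s) * ((16 * g * p%:R ^+ 2 * K ^+ 2) * s) +
  2 * p%:R * ((2 * s) * (K * (2 * K * s))))).
  apply: lerD.
    apply: le_trans (ler_normD _ _) _; apply: lerD => //.
    by rewrite normrM ger0_norm ?mulr_ge0// ler_wpM2l// mulr_ge0.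
  rewrite normrM ger0_norm ?mulr_ge0// ler_pM ?mulr_ge0//.
  by rewrite ler_wpM2l.
rewrite -sN /g le_eqVlt; apply/orP; left; apply/eqP; ring.
Qed.

(** The powers [K ^+ 2] and [K ^+ 3] are absorbed into [1 + K ^+ 4], which is
    where the fourth moment of the operator norm enters. *)
Lemma score_second_moment : 0 <= beta ->
  E (fun x => score x ^+ 2) <=
  N%:R * (6 * p%:R + 16 * p%:R ^+ 3 * beta) *
  (1 + E (fun x => opnorm (local_interaction J x) ^+ 4)).
Proof.
move=> b0; rewrite score_sq_flip.
set c := 6 * p%:R + 16 * p%:R ^+ 3 * beta.
have -> : N%:R * c * (1 + E (fun x => opnorm (local_interaction J x) ^+ 4)) =
    E (fun x => N%:R * c * (1 + opnorm (local_interaction J x) ^+ 4)).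
  by rewrite ising_expectationZ ising_expectationD ising_expectation1.
apply: ising_expectation_le => x /=.
set K := opnorm _.
have K0 : 0 <= K := opnorm_ge0 _.
have -> : \sum_i residual i x * ((score x - score (flip i x)) / 2) =
   (\sum_i residual i x * (score x - score (flip i x))) / 2.
  by rewrite mulr_suml; apply: eq_bigr => i _; rewrite mulrA.
rewrite ler_pdivrMr//; apply: le_trans (ler_norm _) _.
apply: le_trans (score_flip_sum_le x b0) _; rewrite -/K.
have -> : N%:R * c * (1 + K ^+ 4) * 2 = N%:R *
  (12 * p%:R * (1 + K ^+ 4) + 32 * p%:R ^+ 3 * beta * (1 + K ^+ 4)).
  by rewrite /c; ring.
have K2 : K ^+ 2 <= 1 + K ^+ 4.
  by have := sqr_ge0 (K ^+ 2 - 1); have := sqr_ge0 (K ^+ 2); rewrite -!exprM /=; nra.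
have K3 : K ^+ 3 <= 1 + K ^+ 4.
  have := sqr_ge0 (K ^+ 2 - K); have := sqr_ge0 (K ^+ 2); nra.
rewrite ler_wpM2l//; apply: lerD; rewrite ler_wpM2l ?mulr_ge0 ?exprn_ge0//.
Qed.

End Score.

(** * Localization of the maximum pseudo-likelihood estimate *)

Section Pseudolikelihood.
Context {R : realType}.

(** Large entries carry little of the [l1] mass, since
    [\sum |m i| <= \sum m i ^+ 2 / M0] over the entries above [M0]; taking
    [M0 = 2 * K ^+ 2 / eps] leaves half of the mass to the others. Their squares
    are then bounded below by [|m| <= eps / 4 + m ^+ 2 / eps]. *)
Lemma moderate_entries_sum_sq (N : nat) (m : 'I_N -> R) (eps K : R) :
  0 < eps -> 0 < K ->
  eps * N%:R <= \sum_i `|m i| -> \sum_i m i ^+ 2 <= K ^+ 2 * N%:R ->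
  eps ^+ 2 / 4 * N%:R <=
    \sum_i (if `|m i| <= 2 * K ^+ 2 / eps then m i ^+ 2 else 0).
Proof.
move=> eps0 K0 h1 h2; set M0 := 2 * K ^+ 2 / eps; set Q := \sum_i _.
have M00 : 0 < M0 by rewrite divr_gt0// mulr_gt0// exprn_gt0.
have : eps * N%:R <= eps / 4 * N%:R + Q / eps + (\sum_i m i ^+ 2) / M0.
  apply: le_trans h1 _.
  have -> : eps / 4 * N%:R = \sum_(i < N) eps / 4.
    by rewrite sumr_const card_ord mulr_natr.
  rewrite /Q !mulr_suml -!big_split; apply: ler_sum => i _ /=.
  rewrite -[m i ^+ 2]real_normK ?num_real//; set a := `|m i|.
  have a0 : 0 <= a by exact: normr_ge0.
  have [aM|aM] := leP a M0.
    rewrite -[leLHS]addr0 lerD ?mulr_ge0 ?invr_ge0 ?exprn_ge0 ?(ltW M00)//.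
    rewrite -subr_ge0; have -> : eps / 4 + a ^+ 2 / eps - a = (a - eps / 2) ^+ 2 / eps.
      by field; rewrite gt_eqF.
    by rewrite mulr_ge0 ?sqr_ge0// invr_ge0 ltW.
  rewrite mul0r addr0 -[leLHS]add0r lerD ?divr_ge0 ?(ltW eps0)//.
  by rewrite ler_pdivlMr// expr2 ler_wpM2l// ltW.
have : (\sum_i m i ^+ 2) / M0 <= eps / 2 * N%:R.
  rewrite ler_pdivrMr//; apply: le_trans h2 _.
  rewrite le_eqVlt; apply/orP; left; apply/eqP.
  by rewrite /M0; field; rewrite gt_eqF.
move=> h3 h4.
have : eps / 4 * N%:R <= Q / eps by lra.
rewrite ler_pdivlMr//; apply: le_trans.
by rewrite le_eqVlt; apply/orP; left; apply/eqP; ring.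
Qed.

(** Every term is nondecreasing in the parameter; those with [|m i| <= M0] grow
    at a rate bounded below, since there the argument of [tanh] stays in a fixed
    bounded interval. *)
Lemma sum_mtanh_increment (N : nat) (m : 'I_N -> R) (q a b B M0 : R) :
  0 <= q -> 0 <= a -> a <= b -> b <= B -> 0 <= M0 ->
  q * expR (- (2 * (q * B * M0))) * (b - a) *
    \sum_i (if `|m i| <= M0 then m i ^+ 2 else 0) <=
  \sum_i mtanh (q * b) (m i) - \sum_i mtanh (q * a) (m i).
Proof.
move=> q0 a0 ab bB M00.
rewrite mulr_sumr -sumrB; apply: ler_sum => i _.
rewrite /mtanh -mulrBr; set k := m i.
have bnd c : 0 <= c -> c <= B -> `|k| <= M0 -> `|q * c * k| <= q * B * M0.
  move=> c0 cB kM; rewrite normrM (ger0_norm (mulr_ge0 q0 c0)).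
  by rewrite ler_pM ?mulr_ge0// ler_wpM2l.
have b0 := le_trans a0 ab; have aB := le_trans ab bB.
have qab : q * a <= q * b by rewrite ler_wpM2l.
have [k0|k0] := lerP 0 k.
- have akb : q * a * k <= q * b * k by rewrite ler_wpM2r.
  case: ifP => kM; last by rewrite mulr0 mulr_ge0// subr_ge0 tanh_le.
  have h := tanh_incr_lower (bnd _ a0 aB kM) (bnd _ b0 bB kM) akb.
  apply: le_trans (ler_wpM2l k0 h).
  by rewrite le_eqVlt; apply/orP; left; apply/eqP; ring.
- have bka : q * b * k <= q * a * k by rewrite ler_wnM2r// ltW.
  have nk : 0 <= - k by rewrite oppr_ge0 ltW.
  rewrite -[leRHS]mulrNN opprB.
  case: ifP => kM; last by rewrite mulr0 mulr_ge0// subr_ge0 tanh_le.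
  have h := tanh_incr_lower (bnd _ b0 bB kM) (bnd _ a0 aB kM) bka.
  apply: le_trans (ler_wpM2l nk h).
  by rewrite le_eqVlt; apply/orP; left; apply/eqP; ring.
Qed.

Lemma continuous_sum_mtanh (N : nat) (m : 'I_N -> R) (q : R) :
  continuous (fun b : R => \sum_i mtanh (q * b) (m i)).
Proof.
move=> b; apply: differentiable_continuous; apply/derivable1_diffP.
have -> : (fun b : R => \sum_i mtanh (q * b) (m i)) =
    \sum_i (fun b => mtanh (q * b) (m i)).
  by apply/funext => c; rewrite fct_sumE.
apply: derivable_sum => i.
have -> : (fun b => mtanh (q * b) (m i)) =
    m i *: ((fun b => tanh (q * m i * b)) : R -> R).
  by apply/funext => c; rewrite /mtanh fctE mulrAC.
by apply: derivableZ; have /@ex_derive := is_derive_tanhM (q * m i) b.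
Qed.

(** The intermediate value theorem gives a root in the window, and monotonicity
    excludes roots to the left of it. *)
Lemma inf_root_near (f : R -> R) (v b r : R) :
  continuous f ->
  (forall a c, 0 <= a -> a <= c -> f a <= f c) ->
  0 <= r -> r <= b -> f (b - r) < v -> v < f (b + r) ->
  exists2 c, ereal_inf (EFin @` [set a | 0 <= a /\ v = f a]) = c%:E &
    `|c - b| <= r.
Proof.
move=> cf mf r0 rb fl fr; set A := [set a | _].
have br : b - r <= b + r by lra.
have [c] : exists2 c, c \in `[b - r, b + r]%R & f c = v.
  apply: IVT => //; first exact: continuous_subspaceT.
  by rewrite ge_min le_max (ltW fl) (ltW fr) orbT.
rewrite in_itv /= => /andP[lc cr] fc.
have Ac : A c by split; [lra|].
have up : (ereal_inf (EFin @` A) <= c%:E)%E by apply: ereal_inf_lbound; exists c.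
have lo : ((b - r)%:E <= ereal_inf (EFin @` A))%E.
  apply: le_ereal_inf_tmp => _ [a [a0 va] <-]; rewrite lee_fin leNgt.
  apply/negP => abr; have := mf a (b - r) a0 (ltW abr).
  by rewrite -va leNgt fl.
move: up lo; case: (ereal_inf _) => [d| |]//.
rewrite !lee_fin => dc bd; exists d => //.
by rewrite ler_norml; apply/andP; split; lra.
Qed.

Context {p N : nat}.
Variables (J : tensor R p N) (beta : R).
Hypotheses (hp : (2 <= p)%N) (hN : (0 < N)%N).

(** The function [f] of the pseudo-likelihood equation differs from the
    Hamiltonian by at most [L * sqrt N] at [beta], and over a step [M / sqrt N] on
    either side of [beta] it moves by more than that, because its slope is at
    least a constant times [N]. *)
Lemma mpl_near (x : config N) (eps K L M : R) :
  0 < eps -> 0 < K ->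
  L < p%:R * expR (- (2 * (p%:R * (beta + 1) * (2 * K ^+ 2 / eps)))) *
      (eps ^+ 2 / 4) * M ->
  0 < M -> M / Num.sqrt N%:R <= beta -> M / Num.sqrt N%:R <= 1 ->
  eps * N%:R <= hamiltonian J x ->
  opnorm (local_interaction J x) <= K ->
  `|score J beta x| <= L * Num.sqrt N%:R ->
  ((Num.sqrt N%:R)%:E * `|mpl J x - beta%:E| <= M%:E)%E.
Proof.
move=> eps0 K0; set M0 := 2 * K ^+ 2 / eps; set kap := expR _.
have kap0 : 0 <= kap by exact: expR_ge0.
move=> LM M_gt0 rb r1 hH hK hS.
pose s : R := Num.sqrt N%:R.
have s0 : 0 < s by rewrite sqrtr_gt0 ltr0n.
have sN : s * s = N%:R by rewrite -expr2 sqr_sqrtr.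
rewrite -/s in rb r1 hS *; set r := M / s in rb r1 *.
have r0 : 0 < r by rewrite divr_gt0.
have M00 : 0 <= M0 by rewrite divr_ge0 ?mulr_ge0 ?exprn_ge0// ltW.
set m := local_field J x.
pose f (b : R) := \sum_i mtanh (p%:R * b) (m i).
have fH : hamiltonian J x = score J beta x + f beta by rewrite scoreE// subrK.
have m_abs : eps * N%:R <= \sum_i `|m i|.
  apply: le_trans hH _; rewrite hamiltonian_local_field//.
  apply: ler_sum => i _; apply: le_trans (ler_norm _) _.
  by rewrite normrM spin_norm mul1r.
have m_sq : \sum_i m i ^+ 2 <= K ^+ 2 * N%:R.
  apply: le_trans (local_field_sum_sq J hp x) _; rewrite ler_wpM2r//.
  by rewrite lerXn2r ?nnegrE ?opnorm_ge0// ltW.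
have Q := moderate_entries_sum_sq eps0 K0 m_abs m_sq; rewrite -/M0 in Q.
set S := \sum_i _ in Q.
have mono a b : 0 <= a -> a <= b -> f a <= f b.
  move=> a0 ab; rewrite -subr_ge0.
  apply: le_trans (sum_mtanh_increment m (ler0n R p) a0 ab (lexx _) M00).
  rewrite !mulr_ge0 ?expR_ge0 ?subr_ge0//.
  by apply: sumr_ge0 => i _; case: ifP => _; rewrite ?sqr_ge0.
have step a b : 0 <= a -> b = a + r -> b <= beta + 1 -> L * s < f b - f a.
  move=> a0 ba bB; have ab : a <= b by rewrite ba lerDl ltW.
  apply: lt_le_trans (sum_mtanh_increment m (ler0n R p) a0 ab bB M00).
  rewrite -/kap -/S; have -> : b - a = r by rewrite ba; ring.
  apply: (@lt_le_trans _ _ (p%:R * kap * r * (eps ^+ 2 / 4 * N%:R))); last first.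
    by apply: ler_wpM2l Q; rewrite (mulr_ge0 _ (ltW r0))// mulr_ge0.
  rewrite -sN /r.
  have -> : p%:R * kap * (M / s) * (eps ^+ 2 / 4 * (s * s)) =
     p%:R * kap * (eps ^+ 2 / 4) * M * s by field; rewrite gt_eqF.
  by rewrite ltr_pM2r.
move: hS; rewrite ler_norml => /andP[hS1 hS2].
have [||c] := @inf_root_near f (hamiltonian J x) beta r
    (@continuous_sum_mtanh N m p%:R) mono (ltW r0) rb.
- have := step (beta - r) beta; rewrite subr_ge0 subrK => /(_ rb erefl).
  by rewrite lerDl ler01 => /(_ isT); lra.
- have := step beta (beta + r); rewrite (le_trans (ltW r0) rb) lerD2l => /(_ isT erefl r1).
  by lra.
rewrite -[ereal_inf _]/(mpl J x) => -> cb.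
rewrite -EFinB abse_EFin -EFinM lee_fin mulrC -ler_pdivlMr//.
Qed.

End Pseudolikelihood.

(** * Consistency *)

Lemma limn_einf_gt0_lower (R : realType) (u : nat -> R) :
  (0 < limn_einf (fun n => (u n)%:E))%E ->
  exists2 c : R, 0 < c & \forall n \near \oo, c <= u n.
Proof.
rewrite limn_einf_lim (cvg_lim _ (@cvg_einfs_sup _ _))//.
move=> /ereal_sup_gt[_ [n _ <-]]; rewrite /einfs /= => h.
have lb k : (n <= k)%N -> (ereal_inf (sdrop (fun n => (u n)%:E) n) <= (u k)%:E)%E.
  by move=> nk; apply: ereal_inf_lbound; exists k.
move: h lb; case: (ereal_inf _) => [c| |] //.
- rewrite lte_fin => c0 lb; exists c => //.
  by exists n => // k /= nk; have := lb k nk; rewrite lee_fin.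
- by move=> _ /(_ n (leqnn n)).
Qed.

Section GoodEvent.
Context {R : realType} {p N : nat}.
Variables (J : tensor R p N) (beta : R).
Hypotheses (hp : (2 <= p)%N) (hN : (0 < N)%N) (hbeta : 0 <= beta).
Hypotheses (Jsym : symmetric_tensor J) (Jdiag : zero_diagonal J).

(** A union bound over the three ways to fail: low energy, large operator norm,
    and large score; the last two are estimated by Markov's inequality for the
    fourth and second moments. *)
Lemma good_event_prob (eps K L C : R) (T : set (config N)) :
  0 < K -> 0 < L ->
  ising_expectation J beta (fun x => opnorm (local_interaction J x) ^+ 4) <= C ->
  (forall x, eps * N%:R <= hamiltonian J x ->
    opnorm (local_interaction J x) <= K ->
    `|score J beta x| <= L * Num.sqrt N%:R -> T x) ->
  1 - expR (beta * (eps * N%:R) - log_partition J beta) - C / K ^+ 4 -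
    (6 * p%:R + 16 * p%:R ^+ 3 * beta) * (1 + C) / L ^+ 2 <=
  ising_prob J beta T.
Proof.
move=> K0 L0 hC hT; set c := 6 * _ + _.
have c0 : 0 <= c by rewrite addr_ge0// ?mulr_ge0// exprn_ge0.
have N0 : 0 < N%:R :> R by rewrite ltr0n.
have K40 : 0 < K ^+ 4 by rewrite exprn_gt0.
have L20 : 0 < L ^+ 2 by rewrite exprn_gt0.
have LN0 : 0 < L ^+ 2 * N%:R by rewrite mulr_gt0.
have sq4 (y : R) : 0 <= y ^+ 4 by rewrite -[4%N]/(2 * 2)%N exprM sqr_ge0.
pose low x : R := (hamiltonian J x < eps * N%:R)%R%:R.
have union x : 1 <= low x + ((K ^+ 4)^-1 * opnorm (local_interaction J x) ^+ 4 +
    ((L ^+ 2 * N%:R)^-1 * score J beta x ^+ 2 + (x \in T)%:R)).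
  have A0 : 0 <= low x by rewrite ler0n.
  have B0 : 0 <= (K ^+ 4)^-1 * opnorm (local_interaction J x) ^+ 4.
    by rewrite mulr_ge0// invr_ge0 ltW.
  have C0 : 0 <= (L ^+ 2 * N%:R)^-1 * score J beta x ^+ 2.
    by rewrite mulr_ge0 ?sqr_ge0// invr_ge0 ltW.
  have D0 : 0 <= (x \in T)%:R :> R by rewrite ler0n.
  have [h1|h1] := ltP (hamiltonian J x) (eps * N%:R).
    by rewrite /low h1 lerDl !addr_ge0.
  have [h2|h2] := ltP K (opnorm (local_interaction J x)).
    have : 1 <= (K ^+ 4)^-1 * opnorm (local_interaction J x) ^+ 4; last by lra.
    by rewrite mulrC ler_pdivlMr// mul1r lerXn2r ?nnegrE ?opnorm_ge0// ltW.
  have [h3|h3] := ltP (L * Num.sqrt N%:R) (`|score J beta x|).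
    have : 1 <= (L ^+ 2 * N%:R)^-1 * score J beta x ^+ 2; last by lra.
    rewrite mulrC ler_pdivlMr// mul1r -[score _ _ _ ^+ 2]real_normK ?num_real//.
    rewrite -[N%:R]sqr_sqrtr// -exprMn lerXn2r ?nnegrE ?mulr_ge0 ?sqrtr_ge0//.
      exact: ltW.
    exact: ltW.
  rewrite (_ : x \in T); first by rewrite !addrA lerDr !addr_ge0.
  by rewrite inE; exact: hT.
have := ising_expectation_le J beta union.
rewrite ising_expectation1 !ising_expectationD !ising_expectationZ -ising_probE.
have P1 := low_energy_prob J (eps * N%:R) hbeta.
have P2 : (K ^+ 4)^-1 *
    ising_expectation J beta (fun x => opnorm (local_interaction J x) ^+ 4) <=
    C / K ^+ 4 by rewrite mulrC ler_wpM2r// invr_ge0 ltW.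
have P3 : (L ^+ 2 * N%:R)^-1 * ising_expectation J beta (fun x => score J beta x ^+ 2)
    <= c * (1 + C) / L ^+ 2.
  have -> : c * (1 + C) / L ^+ 2 = (L ^+ 2 * N%:R)^-1 * (N%:R * c * (1 + C)).
    by field; rewrite !gt_eqF.
  rewrite ler_wpM2l ?invr_ge0 ?(ltW LN0)//.
  apply: le_trans (score_second_moment hp Jsym Jdiag hbeta) _.
  by rewrite ler_wpM2l ?lerD2l// mulr_ge0.
rewrite -/(low) in P1 *; lra.
Qed.

End GoodEvent.

Theorem theorem2p3 (R : realType) (p : nat) (hp : (2 <= p)%N)
  (beta : R) (hbeta : 0 < beta)
  (J : forall N : nat, tensor R p N)
  (hsym : forall N : nat, (1 <= N)%N -> symmetric_tensor (J N))
  (hdiag : forall N : nat, (1 <= N)%N -> zero_diagonal (J N))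
  (hnorm : (ereal_sup [set (ising_expectation (J N) beta
                (fun z => opnorm (local_interaction (J N) z) ^+ 4))%:E
              | N in [set N : nat | (1 <= N)%N]] < +oo)%E)
  (hlog : (0 < limn_einf (fun N : nat =>
              (N%:R^-1 * log_partition (J N) beta)%:E))%E) :
  forall delta : R, 0 < delta ->
    exists2 M : R, 0 < M &
      \forall N \near \oo,
        1 - delta < ising_prob (J N) beta
          [set x | ((Num.sqrt N%:R)%:E * `|mpl (J N) x - beta%:E| <= M%:E)%E].
Proof.
move=> delta delta0.
have b0 := ltW hbeta.
have [C C0 hC] : exists2 C : R, 0 <= C & forall N, (1 <= N)%N ->
    ising_expectation (J N) beta (fun z => opnorm (local_interaction (J N) z) ^+ 4) <= C.
  set B := ereal_sup _ in hnorm.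
  have ub N : (1 <= N)%N -> ((ising_expectation (J N) beta
      (fun z => opnorm (local_interaction (J N) z) ^+ 4))%:E <= B)%E.
    by move=> N1; apply: ereal_sup_ubound; exists N.
  move: hnorm ub; case: B => [C| |]// _ ub.
    exists `|C| => // N N1; apply: le_trans (ler_norm _).
    by have := ub N N1; rewrite lee_fin.
  by have := ub 1%N isT.
(* With this choice of eps, beta * eps * N is half of the lower bound c * N
   for the log-partition function. *)
have [c c0 hc] := limn_einf_gt0_lower hlog.
pose eps := c / (2 * beta).
have eps0 : 0 < eps by rewrite divr_gt0// mulr_gt0.
pose C1 := (6 * p%:R + 16 * p%:R ^+ 3 * beta) * (1 + C).
have C10 : 0 <= C1.
  by rewrite mulr_ge0// addr_ge0// ?mulr_ge0// exprn_ge0.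
(* K and L are at least 1, so that bounding them below linearly suffices to
   make C / K ^+ 4 and C1 / L ^+ 2 small. *)
pose K := 1 + 4 * C / delta.
have K1 : 1 <= K by rewrite lerDl (divr_ge0 (mulr_ge0 _ C0) (ltW delta0)).
pose L := 1 + 4 * C1 / delta.
have L1 : 1 <= L by rewrite lerDl (divr_ge0 (mulr_ge0 _ C10) (ltW delta0)).
have K0 : 0 < K by lra.
have L0 : 0 < L by lra.
have hK : C / K ^+ 4 <= delta / 4.
  rewrite ler_pdivrMr ?exprn_gt0//.
  apply: (@le_trans _ _ (delta / 4 * K)).
    have -> : delta / 4 * K = delta / 4 + C by rewrite /K; field; rewrite gt_eqF.
    by rewrite lerDr divr_ge0// ltW.
  by rewrite ler_wpM2l ?divr_ge0 ?(ltW delta0)// ler_eXnr.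
have hL : C1 / L ^+ 2 <= delta / 4.
  rewrite ler_pdivrMr ?exprn_gt0//.
  apply: (@le_trans _ _ (delta / 4 * L)).
    have -> : delta / 4 * L = delta / 4 + C1 by rewrite /L; field; rewrite gt_eqF.
    by rewrite lerDr divr_ge0// ltW.
  by rewrite ler_wpM2l ?divr_ge0 ?(ltW delta0)// ler_eXnr.
(* The slope per site of the pseudo-likelihood equation. *)
pose lam := p%:R * expR (- (2 * (p%:R * (beta + 1) * (2 * K ^+ 2 / eps)))) *
      (eps ^+ 2 / 4).
have lam0 : 0 < lam.
  rewrite mulr_gt0 ?divr_gt0 ?exprn_gt0// mulr_gt0 ?expR_gt0// ltr0n.
  exact: ltn_trans hp.
pose M := L / lam + 1.
have M0 : 0 < M by rewrite addr_gt0// divr_gt0.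
have LM : L < lam * M.
  have -> : lam * M = L + lam by rewrite /M; field; rewrite gt_eqF.
  by rewrite ltrDl.
exists M => //.
near=> N.
have N1 : (1 <= N)%N by near: N; exact: nbhs_infty_ge.
have N0 : 0 < N%:R :> R by rewrite ltr0n.
have F : c <= N%:R^-1 * log_partition (J N) beta by near: N.
have s0 : 0 < Num.sqrt N%:R :> R by rewrite sqrtr_gt0.
have rsmall (d : R) : 0 < d -> (M / d) ^+ 2 <= N%:R -> M / Num.sqrt N%:R <= d.
  move=> d0 h; rewrite ler_pdivrMr// mulrC -ler_pdivrMr//.
  rewrite -(@ler_pXn2r _ 2)// ?nnegrE ?(ltW s0) ?divr_ge0 ?(ltW M0) ?(ltW d0)//.
  by rewrite sqr_sqrtr// ltW.
have rb : M / Num.sqrt N%:R <= beta.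
  by apply: rsmall => //; near: N; exact: nbhs_infty_ger.
have r1 : M / Num.sqrt N%:R <= 1.
  by apply: rsmall => //; near: N; exact: nbhs_infty_ger.
have hlow : expR (beta * (eps * N%:R) - log_partition (J N) beta) <= delta / 4.
  have cN : c * N%:R <= log_partition (J N) beta.
    by rewrite mulrC -ler_pdivlMl.
  have -> : beta * (eps * N%:R) = c * N%:R / 2.
    by rewrite /eps; field; rewrite gt_eqF.
  have hN : 8 / (c * delta) <= N%:R by near: N; exact: nbhs_infty_ger.
  have y0 : 4 / delta <= c * N%:R / 2.
    move: hN; rewrite ler_pdivrMr ?mulr_gt0// => hN.
    by rewrite ler_pdivrMr// ; lra.
  apply: (@le_trans _ _ (expR (- (c * N%:R / 2)))).
    by rewrite ler_expR; lra.
  rewrite expRN -[delta / 4]invrK invf_div lef_pV2 ?posrE ?expR_gt0 ?divr_gt0//.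
  by apply: le_trans (expR_ge1Dx _); lra.
apply: lt_le_trans (@good_event_prob R p N (J N) beta hp N1 b0 (hsym N N1)
  (hdiag N N1) eps K L C _ K0 L0 (hC N N1)
  (fun x => mpl_near hp N1 eps0 K0 LM M0 rb r1)).
rewrite -/C1; move: hlow hK hL.
move: (expR _) (C / _) (C1 / _) => u v w.
lra.
Unshelve. all: by end_near.
Qed.
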